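(* Let $N,M\ge 1$, let $A,B_1,\dots,B_M$ be real symmetric $N\times N$ matrices such that $B_{\Sigma}:=\sum_{i=1}^M B_i$ is positive definite, let $S$ be an invertible real $N\times N$ matrix with $B_\Sigma=S^TS$, and put $\tilde A=(S^{-1})^TAS^{-1}$, $\tilde B_i=(S^{-1})^TB_iS^{-1}$ for $i=1,\dots,M$. Let $\mathcal G$ be the symmetry group in orthogonal form and $\mathcal G_1$ its continuous subgroup of symmetries (both defined in the context). Let $\hat G_1,\dots,\hat G_K$ be a basis of the real linear space of all skew-symmetric real $N\times N$ matrices $X$ satisfying the system of linear equations $$\tilde A X = X\tilde A,\qquad \tilde B_i X = X\tilde B_i,\quad i=1,\dots,M.$$ Then $$\mathcal G_1=\left\{\, e^{\sum_{n=1}^K a_n\hat G_n} \;:\; a_1,\dots,a_K\in\mathbb R \right\},$$ where $e^{(\cdot)}$ is the matrix exponential (if $K=0$, the empty sum is the zero matrix and the right-hand side consists of the identity matrix only).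
   Context: The underlying problem is: maximize $x^TAx$ over $x\in\mathbb R^N$ subject to $x^TB_ix\le 1$ for $i=1,\dots,M$. Its linear symmetries are the invertible real matrices $P$ such that $P^TAP=A$ and, for some $M\times M$ permutation matrix $L=(L_{ij})$, $P^TB_iP=\sum_{j=1}^M L_{ij}B_j$ for all $i$. Under the substitution $Q=SPS^{-1}$, this symmetry group is identified with the group $\mathcal G$ of all real orthogonal $N\times N$ matrices $Q$ such that $Q^T\tilde AQ=\tilde A$ and, for some $M\times M$ permutation matrix $L=(L_{ij})$, $Q^T\tilde B_iQ=\sum_{j=1}^M L_{ij}\tilde B_j$ for all $i=1,\dots,M$. The group $\mathcal G$ is endowed with the topology induced from $\mathbb R^{N^2}$ (the space of $N\times N$ matrices). The continuous subgroup of symmetries $\mathcal G_1$ is the connected component of $\mathcal G$ containing the identity matrix. *)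

(* Defs.v *)
From mathcomp Require Import all_boot all_order all_algebra.
From mathcomp Require Import all_classical all_reals all_analysis.

Set Implicit Arguments.
Unset Strict Implicit.
Unset Printing Implicit Defensive.

Import Order.TTheory GRing.Theory Num.Theory.
Import numFieldNormedType.Exports.

Local Open Scope classical_set_scope.
Local Open Scope ring_scope.

Definition symmetric_mx (R : realType) (N : nat) (A : 'M[R]_N) : Prop :=
  A^T = A.

Definition skew_symmetric_mx (R : realType) (N : nat) (A : 'M[R]_N) : Prop :=
  A^T = - A.

Definition orthogonal_mx (R : realType) (N : nat) (Q : 'M[R]_N) : Prop :=
  Q^T *m Q = 1%:M.

Definition posdef_mx (R : realType) (N : nat) (A : 'M[R]_N) : Prop :=
  symmetric_mx A /\
  forall x : 'cV[R]_N, x != 0 -> 0 < (x^T *m A *m x) ord0 ord0.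

(* The limit is taken in the entrywise topology of 'M[R]_N. *)
Definition expmx (R : realType) (N : nat) (X : 'M[R]_N) : 'M[R]_N :=
  lim (series (fun k : nat => (k`!%:R)^-1 *: (X ^+ k)) @ \oo).

Definition symmetry_group (R : realType) (N M : nat) (A : 'M[R]_N)
    (B : 'I_M -> 'M[R]_N) : set 'M[R]_N :=
  [set Q | [/\ orthogonal_mx Q,
               Q^T *m A *m Q = A &
               exists L : 'M[R]_M, is_perm_mx L /\
                 forall i, Q^T *m B i *m Q = \sum_(j < M) L i j *: B j]].

(* [connected_component G x] refers to the topology that G inherits from the
   ambient space, here the entrywise topology of 'M[R]_N. *)
Definition continuous_symmetries (R : realType) (N M : nat) (A : 'M[R]_N)
    (B : 'I_M -> 'M[R]_N) : set 'M[R]_N :=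
  connected_component (symmetry_group A B) 1%:M.

Definition infinitesimal_symmetry (R : realType) (N M : nat) (A : 'M[R]_N)
    (B : 'I_M -> 'M[R]_N) (X : 'M[R]_N) : Prop :=
  [/\ skew_symmetric_mx X,
      A *m X = X *m A &
      forall i, B i *m X = X *m B i].

(* Main.v *)
Require Import Defs.
From mathcomp Require Import all_boot all_order all_algebra.
From mathcomp Require Import all_classical all_reals all_analysis.
From mathcomp Require Import perm ring lra.
From mathcomp.real_closed Require Import complex.

Set Implicit Arguments.
Unset Strict Implicit.
Unset Printing Implicit Defensive.

Import Order.TTheory GRing.Theory Num.Theory.
Import numFieldNormedType.Exports.

Local Open Scope classical_set_scope.
Local Open Scope ring_scope.

(** Let F be the set of the matrices At and Bt i. They are symmetric, so F is
    closed under transposition. Write H for the orthogonal matrices commuting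
    with F and V for the skew-symmetric ones, which are the infinitesimal
    symmetries. The claim is that the identity component of the symmetry group
    is exp(V).

    The curve t |-> exp(tX), for X in V, is continuous and stays in H, hence in
    the symmetry group; this gives one inclusion.

    Conversely let D be a connected set of symmetries containing 1. Each map
    Q |-> Q^T Bt_i Q takes values in the finite set of all the Bt_j on D, so it
    is constant there and D lies in H ([connected_symmetries_commute]). It
    remains to see that exp(V) is open and closed in H, and for this a uniform
    statement suffices ([near_exponential]): if Q0 = exp(X0) with X0 in V, and
    Q in H satisfies tr(Q0 Q^T) > N - 1, then Q is in exp(V). The relation
    tr(x y^T) > N - 1 is symmetric and open, so a connected set cannot cross
    from exp(V) to its complement ([connected_uniform_sub]).

    Surjectivity of exp near a point where exp is singular (when Q0 has the
    eigenvalue -1) is the difficulty. It is resolved by a compactness argument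
    that makes things commute ([variational_commutation]): maximizing
    tr(g M g^T Y) over the compact group H yields a conjugate of M whose
    commutator with Y is symmetric, since the first variation in the direction
    of the skew part of that commutator vanishes. It is used twice.
    - With M = Q0 and Y = Q^T: replacing X0 by a conjugate in V, the matrices
      Q0 Q^T and Q^T Q0 have the same skew part. Both are close to 1, and an
      orthogonal matrix close to 1 is determined by its skew part
      ([orthogonal_near1_eq]), so Q0 commutes with Q.
    - Then Q = U Q0 with U = Q Q0^T close to 1, so U has a skew logarithm Y
      commuting with everything that commutes with U
      ([orthogonal_near1_log]). Adding Q0 and its transpose to F and applying
      the argument to M = X0 and Y, whose commutator is skew, produces X2 in V
      with exp(X2) = Q0 and X2 Y = Y X2. Hence Q = exp(Y) exp(X2) = exp(Y + X2).

    The exponential of a skew matrix X is computed explicitly from the spectral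
    resolution of the symmetric matrix -X^2: the even and odd parts of the
    series become cosines and sines ([expmxE]). Convergence, the derivative of
    t |-> exp(tX), additivity and the logarithm all follow from that formula. *)

(** * Spectral resolution of real symmetric matrices *)

(** Over the complex numbers the matrix is unitarily diagonalizable with real
    eigenvalues, and the product over the distinct ones kills it. Identities
    between real matrices can be checked after complexification. *)
Lemma symmetric_annihilator (R : realType) n (C : 'M[R]_n.+1) :
  C^T = C ->
  exists2 rs : seq R, uniq rs & horner_mx C (\prod_(x <- rs) ('X - x%:P)) = 0.
Proof.
move=> symC.
pose toC := real_complex R.
have CC : map_mx toC C \is hermsymmx.
  apply: realsym_hermsym.
    by rewrite qualifE /= expr0 scale1r map_mx_id // map_trmx symC.
  by apply/mxOverP => i j; rewrite mxE complex_real.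
have /orthomx_spectralP := hermitian_normalmx CC.
have /mxOverP := hermitian_spectral_diag_real CC.
set d := spectral_diag _; set P := spectralmx _ => dreal Cdec.
pose rs := undup [seq complex.Re (d ord0 i) | i <- enum 'I_n.+1].
exists rs; first exact: undup_uniq.
apply: (@map_mx_inj _ _ toC); rewrite map_horner_mx map_mx0.
have Pu : P \in unitmx by exact: spectral_unit.
set p := \prod_(x <- _) _.
rewrite {1}Cdec (horner_mx_uconjC _ _ Pu) horner_mx_diag.
suff -> : map_mx (horner (map_poly toC p)) d = 0 by rewrite linear0 mulmx0 mul0mx.
apply/matrixP => i j; rewrite !mxE ord1 -(RRe_real (dreal ord0 j)) horner_map /=.
rewrite (_ : p.[_] = 0) // /p.
apply/rootP; rewrite root_prod_XsubC mem_undup.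
by apply/mapP; exists j; rewrite ?mem_enum.
Qed.

Definition idempotent_resolution (R : realType) n k (P : 'I_k -> 'M[R]_n) :=
  \sum_i P i = 1%:M /\ forall i j, P i *m P j = if i == j then P i else 0.

(** The projections are the Lagrange interpolation polynomials at the eigenvalues,
    evaluated at [C]. Being polynomials in [C], they are symmetric and commute
    with the whole commutant of [C], so that every function of [C] stays in
    whatever algebra [C] lives in. A projection may be zero: the points of
    interpolation come from an annihilating polynomial. *)
Lemma spectral_resolution (R : realType) n (C : 'M[R]_n.+1) : C^T = C ->
  exists k (c : 'I_k -> R) (P : 'I_k -> 'M[R]_n.+1),
    [/\ idempotent_resolution P, C = \sum_i c i *: P i,
        forall i, (P i)^T = P i &
        forall i T, C *m T = T *m C -> P i *m T = T *m P i].
Proof.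
move=> symC; have [rs urs annC] := symmetric_annihilator symC.
pose k := size rs; pose c (i : 'I_k) := rs`_i.
have cinj : injective c.
  by move=> i j /eqP; rewrite /c nth_uniq // => /eqP /val_inj.
(* Evaluation at C only sees the values at the points c i. *)
have vanish p : (forall i, p.[c i] = 0) -> horner_mx C p = 0.
  move=> p0; have /dvdpP [q ->] : \prod_(x <- rs) ('X - x%:P) %| p.
    apply: uniq_roots_dvdp; last by rewrite uniq_rootsE.
    apply/allP => x /(nthP 0) [i ik <-]; apply/rootP.
    exact: (p0 (Ordinal ik)).
  by rewrite rmorphM /= annC mulr0.
pose ell i : {poly R} := \prod_(j | j != i) ((c i - c j)^-1 *: ('X - (c j)%:P)).
have ellE i j : (ell i).[c j] = (i == j)%:R.
  rewrite horner_prod; have [<-|nij] := eqVneq i j.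
    rewrite big1 // => l nli; rewrite !hornerE mulVf //.
    by rewrite subr_eq0 (inj_eq cinj) eq_sym.
  by rewrite (bigD1 j) 1?eq_sym //= !hornerE subrr mulr0 mul0r.
exists k, c, (fun i => horner_mx C (ell i)); split.
- split=> [|i j].
    apply/eqP; rewrite -subr_eq0 -[1%:M](rmorph1 (horner_mx C)) -rmorph_sum -rmorphB.
    apply/eqP/vanish => j; rewrite !hornerE horner_sum (bigD1 j) //= ellE eqxx.
    by rewrite big1 ?addr0 ?subrr // => i /negPf ij; rewrite ellE ij.
  rewrite -[LHS]/(horner_mx C (ell i) * horner_mx C (ell j)) -rmorphM.
  have [<-|nij] := eqVneq i j; last first.
    apply: vanish => l; rewrite !hornerE !ellE.
    by have [<-|] := eqVneq i l; rewrite ?mul0r // (negPf (_ : j != i)) ?mulr0 // eq_sym.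
  apply/eqP; rewrite -subr_eq0 -rmorphB; apply/eqP/vanish => l.
  by rewrite !hornerE ellE; case: eqP => _; rewrite ?mulr1 ?mul0r ?subrr.
- rewrite -{1}[C]horner_mx_X; apply/eqP.
  under eq_bigr do rewrite -linearZ.
  rewrite -subr_eq0 -linear_sum -rmorphB; apply/eqP/vanish => j.
  rewrite !hornerE horner_sum (bigD1 j) //= !hornerE ellE eqxx mulr1.
  by rewrite big1 ?addr0 ?subrr // => i /negPf ij; rewrite hornerE ellE ij mulr0.
- move=> i; elim/poly_ind: (ell i) => [|p a IH]; first by rewrite rmorph0 trmx0.
  rewrite rmorphD rmorphM /= horner_mx_X horner_mx_C linearD /= tr_scalar_mx.
  rewrite [_ * _]/(_ *m _) trmx_mul IH symC; congr (_ + _).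
  by apply: comm_mx_horner.
- by move=> i T CT; apply: comm_horner_mx.
Qed.

(** * Limits of matrix-valued functions *)

Lemma mx_cvg (R : realType) (T : Type) (F : set_system T) m n
    (f : T -> 'M[R]_(m, n)) (L : 'M[R]_(m, n)) : Filter F ->
  (forall i j, f x i j @[x --> F] --> L i j) -> f @ F --> L.
Proof.
move=> FF fL A [P LP sPA]; apply: (@filterS _ _ _ [set x | forall i j, P i j (f x i j)]).
  by move=> x Px; exact: sPA.
apply: filter_forall => i; apply: filter_forall => j; exact: fL (LP i j).
Qed.

Lemma cvg_coord (R : realType) (T : Type) (F : set_system T) m n
    (f : T -> 'M[R]_(m, n)) (L : 'M[R]_(m, n)) i j : Filter F ->
  f @ F --> L -> f x i j @[x --> F] --> L i j.
Proof.
by move=> FF fL; apply: (cvg_comp f (fun M : 'M[R]_(m, n) => M i j) fL); exact: coord_continuous.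
Qed.

Lemma mx_cvg_sum (R : realType) (T : Type) (F : set_system T) m n (I : Type) (r : seq I)
    (f : I -> T -> 'M[R]_(m, n)) (L : I -> 'M[R]_(m, n)) : Filter F ->
  (forall i, f i @ F --> L i) ->
  (fun x => \sum_(i <- r) f i x) @ F --> \sum_(i <- r) L i.
Proof.
move=> FF fL; apply: cvg_big => //; exact: add_continuous.
Qed.

Lemma cvg_mulmx (R : realType) (T : Type) (F : set_system T) m n p
    (f : T -> 'M[R]_(m, n)) (g : T -> 'M[R]_(n, p)) (L : 'M[R]_(m, n))
    (L' : 'M[R]_(n, p)) : Filter F ->
  f @ F --> L -> g @ F --> L' -> (fun x => f x *m g x) @ F --> L *m L'.
Proof.
move=> FF fL gL; apply: mx_cvg => i j.
rewrite mxE; under eq_cvg do rewrite mxE.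
apply: cvg_big => [|k _]; first exact: add_continuous.
by apply: cvgM; exact: cvg_coord.
Qed.

Lemma cvg_trmx (R : realType) (T : Type) (F : set_system T) m n
    (f : T -> 'M[R]_(m, n)) (L : 'M[R]_(m, n)) : Filter F ->
  f @ F --> L -> (fun x => (f x)^T) @ F --> L^T.
Proof.
move=> FF fL; apply: mx_cvg => i j.
rewrite mxE; under eq_cvg do rewrite mxE.
exact: cvg_coord.
Qed.

Lemma cvg_mxtrace (R : realType) (T : Type) (F : set_system T) n
    (f : T -> 'M[R]_n) (L : 'M[R]_n) : Filter F ->
  f @ F --> L -> (fun x => \tr (f x)) @ F --> \tr L.
Proof.
move=> FF fL; apply: cvg_big => [|k _]; first exact: add_continuous.
exact: cvg_coord.
Qed.

(** * The exponential of a skew-symmetric matrix *)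

Lemma resolution_mul (R : realType) n k (P : 'I_k -> 'M[R]_n) (a b : 'I_k -> R) :
  idempotent_resolution P ->
  (\sum_i a i *: P i) *m (\sum_i b i *: P i) = \sum_i (a i * b i) *: P i.
Proof.
move=> [_ PP]; rewrite mulmx_suml; apply: eq_bigr => i _.
rewrite mulmx_sumr (bigD1 i) //= big1 ?addr0.
  by rewrite -scalemxAl -scalemxAr PP eqxx scalerA.
by move=> j /negPf ji; rewrite -scalemxAl -scalemxAr PP eq_sym ji !scaler0.
Qed.

Lemma resolution_exp (R : realType) n k (P : 'I_k -> 'M[R]_n.+1) (a : 'I_k -> R) m :
  idempotent_resolution P ->
  (\sum_i a i *: P i) ^+ m = \sum_i (a i ^+ m) *: P i.
Proof.
move=> resP; elim: m => [|m IH].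
  rewrite expr0 (_ : 1 = 1%:M) //; case: resP => <- _.
  by apply: eq_bigr => i _; rewrite scale1r.
by rewrite exprS IH [LHS]resolution_mul //; apply: eq_bigr => i _; rewrite exprS.
Qed.

Definition sinc (R : realType) (x : R) : R := if x == 0 then 1 else sin x / x.

(** Coefficients of the power series of [sinc], indexed by the exponent of
    the odd power series of [sin] that they come from. *)
Definition sinc_coeff (R : realType) (x : R) (k : nat) : R :=
  if x == 0 then (k == 1)%:R else sin_coeff x k / x.

Lemma cvg_series_sinc (R : realType) (x : R) :
  series (sinc_coeff x) @ \oo --> sinc x.
Proof.
rewrite /sinc /sinc_coeff; have [x0|x0] := eqVneq x 0.
  apply: cvg_near_cst; exists 2 => // k /= k2.
  rewrite /series /= (bigD1_seq 1) //= ?iota_uniq ?mem_index_iota //.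
  by rewrite big1 ?addr0 // => i /negPf ->.
rewrite (_ : series _ = (fun k => series (sin_coeff x) k * x^-1)); last first.
  by apply/funext => k; rewrite /series /= mulr_suml.
apply: cvgMr_tmp; rewrite sin.unlock; exact: is_cvg_series_sin_coeff.
Qed.

(** The squared matrix acts as the scalar -th_i^2 on the range of P_i, so even
    powers give the cosine coefficients and odd powers are [X] times the
    coefficients of sin(th)/th. *)
Lemma exp_term (R : realType) n k (P : 'I_k -> 'M[R]_n.+1) (th : 'I_k -> R)
    (X : 'M[R]_n.+1) (l : nat) :
  idempotent_resolution P -> X *m X = - \sum_i (th i ^+ 2) *: P i ->
  (l`!%:R)^-1 *: X ^+ l =
  \sum_i cos_coeff (th i) l *: P i + X *m \sum_i sinc_coeff (th i) l *: P i.
Proof.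
move=> resP X2.
have Xeven m : X ^+ m.*2 = \sum_i ((- (th i ^+ 2)) ^+ m) *: P i.
  rewrite -mul2n exprM expr2 [X * X]X2 -sumrN.
  rewrite -resolution_exp //; congr (_ ^+ _).
  by apply: eq_bigr => i _; rewrite scaleNr.
have powE x m : (- (x ^+ 2)) ^+ m = (-1) ^+ m * x ^+ m.*2 :> R.
  by rewrite -mulN1r exprMn -exprM mul2n.
rewrite -(odd_double_half l); case: (odd l) => /=; set m := l./2.
- rewrite add1n big1 ?add0r; last by move=> i _; rewrite cos_coeff_odd scale0r.
  rewrite exprS Xeven [X * _]/(X *m _) scalemxAr scaler_sumr; congr (_ *m _).
  apply: eq_bigr => i _; rewrite scalerA powE; congr (_ *: _).
  rewrite /sinc_coeff; have [->|th0] := eqVneq (th i) 0.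
    case: m => [|m]; first by rewrite /= !expr0 invr1 !mulr1.
    by rewrite doubleS expr0n /= !mulr0.
  rewrite /sin_coeff /= odd_double /= mul1r doubleK exprSr.
  by field; rewrite th0 pnatr_eq0 -lt0n fact_gt0.
- rewrite add0n [X in _ + X](_ : _ = 0) ?addr0; last first.
    rewrite big1 ?mulmx0 // => i _; rewrite /sinc_coeff sin_coeff_even mul0r.
    case: eqP => _; last by rewrite scale0r.
    by rewrite (_ : (_ == _) = false) ?scale0r //; case: (m).
  rewrite Xeven scaler_sumr; apply: eq_bigr => i _; rewrite scalerA powE.
  by rewrite /cos_coeff /= odd_double /= mul1r doubleK mulrC.
Qed.

Lemma expmx_series_cvg (R : realType) n k (P : 'I_k -> 'M[R]_n.+1) (th : 'I_k -> R)
    (X : 'M[R]_n.+1) :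
  idempotent_resolution P -> X *m X = - \sum_i (th i ^+ 2) *: P i ->
  series (fun l : nat => (l`!%:R)^-1 *: (X ^+ l)) @ \oo -->
  \sum_i cos (th i) *: P i + X *m \sum_i sinc (th i) *: P i.
Proof.
move=> resP X2.
rewrite (_ : series _ = (fun m => \sum_i series (cos_coeff (th i)) m *: P i +
   X *m \sum_i series (sinc_coeff (th i)) m *: P i)); last first.
  apply/funext => m; rewrite /series /=.
  under eq_bigr do rewrite (exp_term _ resP X2).
  rewrite big_split /= -mulmx_sumr.
  congr (_ + _); last congr (_ *m _); rewrite exchange_big;
    by apply: eq_bigr => i _; rewrite scaler_suml.
apply: cvgD.
  apply: mx_cvg_sum => i; apply: cvgZr_tmp.
  by rewrite cos.unlock; exact: is_cvg_series_cos_coeff.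
apply: cvg_mulmx; first exact: cvg_cst.
apply: mx_cvg_sum => i; apply: cvgZr_tmp; exact: cvg_series_sinc.
Qed.

Lemma expmx_lim (R : realType) n (X E : 'M[R]_n.+1) :
  series (fun l : nat => (l`!%:R)^-1 *: (X ^+ l)) @ \oo --> E -> expmx X = E.
Proof. by move=> XE; apply: cvg_lim => //; exact: norm_hausdorff. Qed.

(** Matrix form of Euler's formula, the [th i] being the angles of rotation. *)
Lemma expmxE (R : realType) n k (P : 'I_k -> 'M[R]_n.+1) (th : 'I_k -> R)
    (X : 'M[R]_n.+1) :
  idempotent_resolution P -> X *m X = - \sum_i (th i ^+ 2) *: P i ->
  expmx X = \sum_i cos (th i) *: P i + X *m \sum_i sinc (th i) *: P i.
Proof. by move=> resP X2; exact/expmx_lim/expmx_series_cvg. Qed.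

Lemma frobenius_ge0 (R : realType) m n (M : 'M[R]_(m, n)) : 0 <= \tr (M^T *m M).
Proof.
apply: sumr_ge0 => a _; rewrite mxE; apply: sumr_ge0 => b _.
by rewrite mxE -expr2 sqr_ge0.
Qed.

Lemma frobenius_eq0 (R : realType) m n (M : 'M[R]_(m, n)) :
  \tr (M^T *m M) = 0 -> M = 0.
Proof.
move=> tr0; apply/matrixP => i j; rewrite [RHS]mxE.
have sqr_ge a : 0 <= (M^T *m M) a a.
  by rewrite mxE; apply: sumr_ge0 => b _; rewrite mxE -expr2 sqr_ge0.
have /(_ j isT) := psumr_eq0P (fun a _ => sqr_ge a) tr0.
rewrite mxE => /psumr_eq0P /(_ i isT) => H.
apply/eqP; rewrite -sqrf_eq0 expr2; apply/eqP; rewrite -{1}[M]trmxK mxE.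
by apply: H => b _; rewrite mxE -expr2 sqr_ge0.
Qed.

(** For [X] skew, -X^2 = X^T X is positive semidefinite, so its eigenvalues
    have square roots. *)
Lemma skew_square_resolution (R : realType) n (X : 'M[R]_n.+1) : X^T = - X ->
  exists k (th : 'I_k -> R) (P : 'I_k -> 'M[R]_n.+1),
    idempotent_resolution P /\ X *m X = - \sum_i (th i ^+ 2) *: P i.
Proof.
move=> skX.
have [|k [c [P [resP C Psym _]]]] := @spectral_resolution _ _ (- (X *m X)).
  by rewrite linearN /= trmx_mul skX mulNmx mulmxN opprK.
exists k, (fun i => Num.sqrt (c i)), P; split => //.
rewrite -[LHS]opprK C; congr (- _); apply: eq_bigr => i _.
have [c0|c0] := leP 0 (c i); first by rewrite sqr_sqrtr.
(* A negative eigenvalue occurs only with a zero projection, because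
the squared norm of X P_i is c_i times that of P_i. *)
suff -> : P i = 0 by rewrite !scaler0.
have trP : \tr ((X *m P i)^T *m (X *m P i)) = c i * \tr ((P i)^T *m P i).
  rewrite trmx_mul skX Psym mulmxN mulNmx -mulmxA (mulmxA X) -mulmxN -mulNmx C.
  rewrite mulmx_suml mulmx_sumr (bigD1 i) //= big1 ?addr0; last first.
    by move=> j /negPf ji; rewrite -scalemxAl resP.2 ji scaler0 mulmx0.
  by rewrite -scalemxAl -scalemxAr mxtraceZ !(resP.2, eqxx).
apply: frobenius_eq0.
have := frobenius_ge0 (X *m P i); rewrite trP nmulr_rge0 // => le0.
by apply: le_anti; rewrite le0 frobenius_ge0.
Qed.

Lemma skew_expmx_cvg (R : realType) n (X : 'M[R]_n.+1) : X^T = - X ->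
  series (fun l : nat => (l`!%:R)^-1 *: (X ^+ l)) @ \oo --> expmx X.
Proof.
move=> /skew_square_resolution [k [th [P [resP X2]]]].
rewrite (expmxE resP X2); exact: expmx_series_cvg.
Qed.

Lemma expmx0 (R : realType) n : expmx (0 : 'M[R]_n.+1) = 1%:M.
Proof.
apply: expmx_lim; apply: cvg_near_cst; exists 1 => // m /= m1.
rewrite /series /= big_ltn // expr0 invr1 scale1r big_nat big1 ?addr0 //.
by move=> [|l] // _; rewrite expr0n scaler0.
Qed.

Lemma expmx_conj (R : realType) n (g X : 'M[R]_n.+1) : g^T *m g = 1%:M ->
  X^T = - X -> expmx (g *m X *m g^T) = g *m expmx X *m g^T.
Proof.
move=> og skX; apply: expmx_lim.
rewrite (_ : series _ = (fun m => g *m series (fun l : nat => (l`!%:R)^-1 *: (X ^+ l)) m *m g^T)).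
  apply: cvg_mulmx; last exact: cvg_cst.
  by apply: cvg_mulmx; [exact: cvg_cst|exact: skew_expmx_cvg].
apply/funext => m; rewrite /series /= mulmx_sumr mulmx_suml.
apply: eq_bigr => l _; rewrite -scalemxAr -scalemxAl; congr (_ *: _).
elim: l => [|l IH]; first by rewrite !expr0 mulmx1 (mulmx1C og).
rewrite !exprS IH -[LHS]/(_ *m _) -[X * _]/(X *m _).
by rewrite -!mulmxA (mulmxA g^T g) og mul1mx.
Qed.

Lemma trmx_expmx (R : realType) n (X : 'M[R]_n.+1) :
  X^T = - X -> (expmx X)^T = expmx (- X).
Proof.
move=> skX; rewrite -skX; apply/esym/expmx_lim.
rewrite (_ : series _ = (fun m => (series (fun l : nat => (l`!%:R)^-1 *: (X ^+ l)) m)^T)).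
  by apply: cvg_trmx; exact: skew_expmx_cvg.
apply/funext => m; rewrite /series /= linear_sum /=.
apply: eq_bigr => l _; rewrite linearZ /=; congr (_ *: _).
elim: l => [|l IH]; first by rewrite !expr0 trmx1.
by rewrite exprS IH exprSr -[RHS]/(_ *m _)^T trmx_mul.
Qed.

Lemma expmx_comm (R : realType) n (T X : 'M[R]_n.+1) :
  X^T = - X -> T *m X = X *m T -> T *m expmx X = expmx X *m T.
Proof.
move=> skX TX.
have XE := skew_expmx_cvg skX; pose s := series (fun l : nat => (l`!%:R)^-1 *: (X ^+ l)).
have L1 : (fun m => T *m s m) @ \oo --> T *m expmx X.
  by apply: cvg_mulmx => //; exact: cvg_cst.
have L2 : (fun m => s m *m T) @ \oo --> expmx X *m T.
  by apply: cvg_mulmx => //; exact: cvg_cst.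
apply: (cvg_unique (@norm_hausdorff _ _) L1); rewrite (_ : (fun _ => _) = (fun m => s m *m T)) //.
apply/funext => m; rewrite /s /series /= mulmx_sumr mulmx_suml.
apply: eq_bigr => l _; rewrite -scalemxAr -scalemxAl; congr (_ *: _).
exact: (commrX l TX).
Qed.

Lemma is_derive_sumfun (R : realType) k (f : 'I_k -> R -> R) (df : 'I_k -> R) (t : R) :
  (forall i, is_derive t (1 : R) (f i) (df i)) ->
  is_derive t (1 : R) (fun s => \sum_i f i s) (\sum_i df i).
Proof.
move=> fd; rewrite (_ : (fun s => _) = \sum_i f i); first exact: is_derive_sum.
by apply/funext => s; rewrite fct_sumE.
Qed.

(** Entrywise derivation, so that the product rule reduces to that of scalar functions. *)
Definition mx_is_derive (R : realType) m n (F F' : R -> 'M[R]_(m, n)) :=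
  forall (t : R) i j, is_derive t (1 : R) (fun s => F s i j) (F' t i j).

Lemma mx_is_derive_mulmx (R : realType) m n p (F F' : R -> 'M[R]_(m, n))
    (G G' : R -> 'M[R]_(n, p)) :
  mx_is_derive F F' -> mx_is_derive G G' ->
  mx_is_derive (fun t => F t *m G t) (fun t => F' t *m G t + F t *m G' t).
Proof.
move=> dF dG t i j; rewrite (_ : (fun _ => _) = (fun s => \sum_l F s i l * G s l j)); last first.
  by apply/funext => s; rewrite mxE.
rewrite 3!mxE -big_split /=; apply: is_derive_sumfun => l.
apply: (is_derive_eq (is_deriveM (dF t i l) (dG t l j))).
by rewrite addrC /GRing.scale /= [G t l j * _]mulrC.
Qed.

Lemma mx_is_derive_cst (R : realType) m n (A : 'M[R]_(m, n)) :
  mx_is_derive (fun=> A) (fun=> 0).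
Proof. by move=> t i j; rewrite mxE; exact: is_derive_cst. Qed.

Lemma mx_is_derive_add (R : realType) m n (F F' G G' : R -> 'M[R]_(m, n)) :
  mx_is_derive F F' -> mx_is_derive G G' ->
  mx_is_derive (fun t => F t + G t) (fun t => F' t + G' t).
Proof.
move=> dF dG t i j; rewrite mxE (_ : (fun _ => _) = (fun s => F s i j) + (fun s => G s i j)).
  exact: is_deriveD.
by apply/funext => s; rewrite mxE.
Qed.

Lemma mx_is_derive_sum (R : realType) m n k (f f' : 'I_k -> R -> R) (P : 'I_k -> 'M[R]_(m, n)) :
  (forall i (t : R), is_derive t (1 : R) (f i) (f' i t)) ->
  mx_is_derive (fun t => \sum_i f i t *: P i) (fun t => \sum_i f' i t *: P i).
Proof.
move=> df t a b; rewrite (_ : (fun _ => _) = (fun s => \sum_i P i a b * f i s)); last first.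
  apply/funext => s; rewrite summxE; apply: eq_bigr => i _.
  by rewrite mxE mulrC.
rewrite summxE; apply: is_derive_sumfun => i.
apply: (is_derive_eq (is_deriveZ (P i a b) (df i t))).
by rewrite mxE mulrC.
Qed.

Lemma mx_is_derive0 (R : realType) m n (F : R -> 'M[R]_(m, n)) (s t : R) :
  mx_is_derive F (fun=> 0) -> F s = F t.
Proof.
move=> dF; apply/matrixP => i j.
apply: (is_derive_0_is_cst (f := fun u => F u i j)) => u.
by have := dF u i j; rewrite mxE.
Qed.

Lemma mx_is_derive_cvg (R : realType) m n (F F' : R -> 'M[R]_(m, n)) :
  mx_is_derive F F' -> continuous F.
Proof.
move=> dF t; apply: mx_cvg => i j.
have dFt := dF t i j.
exact/differentiable_continuous/derivable1_diffP.
Qed.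

(** In the formula for exp(tX) the only dependence on [t] is through
    cos(t th) and sin(t th)/th, the latter read as [t] when th = 0. *)
Lemma expmx_is_derive (R : realType) n (X : 'M[R]_n.+1) : X^T = - X ->
  mx_is_derive (fun t => expmx (t *: X)) (fun t => X *m expmx (t *: X)).
Proof.
move=> /skew_square_resolution [k [th [P [resP X2]]]].
pose S i (t : R) := if th i == 0 then t else (th i)^-1 * sin (t * th i).
have expE t : expmx (t *: X) =
    \sum_i cos (t * th i) *: P i + X *m \sum_i S i t *: P i.
  rewrite (@expmxE _ _ _ _ (fun i => t * th i) _ resP); last first.
    rewrite -scalemxAl -scalemxAr X2 !scalerN scalerA scaler_sumr; congr (- _).
    by apply: eq_bigr => i _; rewrite scalerA exprMn.
  rewrite -scalemxAl scalemxAr scaler_sumr; congr (_ + _ *m _).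
  apply: eq_bigr => i _; rewrite scalerA; congr (_ *: _).
  rewrite /sinc /S mulf_eq0.
  have [->|t0] := eqVneq t 0; first by rewrite !mul0r sin0 mulr0; case: ifP.
  have [->|th0] /= := eqVneq (th i) 0; first by rewrite mulr1.
  by field; rewrite t0 th0.
have dmul (c t : R) : is_derive t (1 : R) (fun s : R => s * c) c.
  rewrite (_ : (fun s => s * c) = c \*: id).
    by apply: (is_derive_eq (is_deriveZ c (is_derive_id t (1 : R)))); rewrite [LHS]mulr1.
  by apply/funext => s; rewrite /= [LHS]mulrC.
have dcos i t : is_derive t (1 : R) (fun s => cos (s * th i)) (- (th i * sin (t * th i))).
  have := @is_derive1_comp _ (@cos R) (fun s => s * th i) t _ _
    (is_derive_cos (t * th i)) (dmul (th i) t).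
  move=> D; apply: (is_derive_eq D).
  by rewrite mulNr mulrC.
have dS i t : is_derive t (1 : R) (S i) (cos (t * th i)).
  rewrite /S; have [->|th0] := eqVneq (th i) 0.
    by rewrite mulr0 cos0; exact: is_derive_id.
  have := @is_derive1_comp _ (@sin R) (fun s => s * th i) t _ _
    (is_derive_sin (t * th i)) (dmul (th i) t).
  move=> /(is_deriveZ (th i)^-1) D; apply: (is_derive_eq D).
  by rewrite /GRing.scale /= mulrC mulfK.
have := mx_is_derive_add (mx_is_derive_sum P dcos)
  (mx_is_derive_mulmx (mx_is_derive_cst X) (mx_is_derive_sum P dS)).
move=> D t i j; have {D} := D t i j.
rewrite (_ : (fun s => fun_of_matrix (_ + _) i j) = (fun s => expmx (s *: X) i j)); last first.
  by apply/funext => s; rewrite expE.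
move=> D; apply: (is_derive_eq D); congr (fun_of_matrix _ i j).
rewrite mul0mx add0r expE mulmxDr addrC; congr (_ + _).
rewrite mulmxA X2 mulNmx resolution_mul // -sumrN; apply: eq_bigr => l _.
rewrite scaleNr; congr (- (_ *: _)).
rewrite /S; have [->|th0] := eqVneq (th l) 0; first by rewrite expr0n !mul0r.
by field.
Qed.

(** The product exp(tX) exp(-tX) has derivative zero. *)
Lemma expmxND (R : realType) n (X : 'M[R]_n.+1) : X^T = - X ->
  expmx X *m expmx (- X) = 1%:M.
Proof.
move=> skX.
have skNX : (- X)^T = - - X by rewrite linearN /= skX.
have := mx_is_derive_mulmx (expmx_is_derive skX) (expmx_is_derive skNX).
set F' := (F' in mx_is_derive _ F'); move=> dF.
have F'0 : F' = (fun=> 0).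
  apply/funext => t; rewrite /F'.
  have comm : X *m expmx (t *: X) = expmx (t *: X) *m X.
    by apply: expmx_comm; [rewrite linearZ /= skX scalerN|rewrite -scalemxAr -scalemxAl].
  by rewrite comm -mulmxA -mulmxDr mulNmx subrr mulmx0.
rewrite F'0 in dF; have := mx_is_derive0 1 0 dF.
by rewrite !scale1r !scale0r expmx0 mulmx1.
Qed.

Lemma expmx_orthogonal (R : realType) n (X : 'M[R]_n.+1) : X^T = - X ->
  (expmx X)^T *m expmx X = 1%:M.
Proof. by move=> skX; apply: mulmx1C; rewrite trmx_expmx // expmxND. Qed.

(** The product exp(tX) exp(tY) exp(-t(X+Y)) has derivative zero. *)
Lemma expmxD (R : realType) n (X Y : 'M[R]_n.+1) : X^T = - X -> Y^T = - Y ->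
  X *m Y = Y *m X -> expmx (X + Y) = expmx X *m expmx Y.
Proof.
move=> skX skY XY; set Z := X + Y.
have skZ : Z^T = - Z by rewrite linearD /= skX skY opprD.
have skNZ : (- Z)^T = - - Z by rewrite linearN /= skZ.
have := mx_is_derive_mulmx (mx_is_derive_mulmx (expmx_is_derive skX) (expmx_is_derive skY))
  (expmx_is_derive skNZ).
set F' := (F' in mx_is_derive _ F'); move=> dF.
have F'0 : F' = (fun=> 0).
  apply/funext => t; rewrite /F'.
  have cm (A B : 'M[R]_n.+1) : A *m B = B *m A -> B^T = - B ->
      A *m expmx (t *: B) = expmx (t *: B) *m A.
    move=> AB skB; apply: expmx_comm; first by rewrite linearZ /= skB scalerN.
    by rewrite -scalemxAr -scalemxAl AB.
  have XX := cm X X erefl skX; have YY := cm Y Y erefl skY.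
  have XY' := cm X Y XY skY.
  have YX' := cm Y X (esym XY) skX.
  have -> : X *m expmx (t *: X) *m expmx (t *: Y) + expmx (t *: X) *m (Y *m expmx (t *: Y))
     = expmx (t *: X) *m expmx (t *: Y) *m Z.
    rewrite mulmxDr; congr (_ + _); last by rewrite YY mulmxA.
    by rewrite XX -mulmxA XY' mulmxA.
  by rewrite mulNmx mulmxN -!mulmxA subrr.
rewrite F'0 in dF; have := mx_is_derive0 1 0 dF.
rewrite !scale1r !scale0r expmx0 !mulmx1 => H.
rewrite -[LHS]mul1mx -H -mulmxA (mulmx1C (expmxND skZ)) mulmx1 //.
Qed.

(** * Logarithms of orthogonal matrices near the identity *)

Lemma trmxB (R : zmodType) m n (A B : 'M[R]_(m, n)) : (A - B)^T = A^T - B^T.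
Proof. exact: raddfB. Qed.

Lemma mxtraceB (R : pzRingType) n (A B : 'M[R]_n) : \tr (A - B) = \tr A - \tr B.
Proof. exact: raddfB. Qed.

Lemma mxtraceN (R : pzRingType) n (A : 'M[R]_n) : \tr (- A) = - \tr A.
Proof. exact: raddfN. Qed.

Lemma cauchy_schwarz_sum (R : realType) n (x y : 'I_n -> R) :
  (\sum_i x i * y i) ^+ 2 <= (\sum_i x i ^+ 2) * (\sum_i y i ^+ 2).
Proof.
rewrite -subr_ge0 -(pmulrn_lge0 _ (isT : 0 < 2)%N).
rewrite [leRHS](_ : _ = \sum_i \sum_j (x i * y j - x j * y i) ^+ 2).
  by apply: sumr_ge0 => i _; apply: sumr_ge0 => j _; exact: sqr_ge0.
transitivity (\sum_i \sum_j (x i ^+ 2 * y j ^+ 2 + x j ^+ 2 * y i ^+ 2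
    - (x i * y i) * (x j * y j) *+ 2)); last first.
  by apply: eq_bigr => i _; apply: eq_bigr => j _; ring.
under [RHS]eq_bigr do rewrite sumrB big_split /=.
rewrite sumrB big_split /= [X in _ = _ + X - _]exchange_big /= -mulr2n.
rewrite mulrnBl big_distrlr; congr (_ - _).
rewrite expr2 big_distrlr /= -sumrMnl; apply: eq_bigr => i _.
by rewrite -sumrMnl.
Qed.

Lemma frobenius_mul_le (R : realType) m n p (M : 'M[R]_(m, n)) (D : 'M[R]_(n, p)) :
  \tr ((M *m D)^T *m (M *m D)) <= \tr (M^T *m M) * \tr (D^T *m D).
Proof.
have trE q r (A : 'M[R]_(q, r)) : \tr (A^T *m A) = \sum_j \sum_i A i j ^+ 2.
  by apply: eq_bigr => j _; rewrite mxE; apply: eq_bigr => i _; rewrite mxE expr2.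
rewrite !trE exchange_big (exchange_big _ _ _ _ _ (fun j i => M i j ^+ 2)) /=.
rewrite big_distrlr /=; apply: ler_sum => i _; apply: ler_sum => j _.
by rewrite mxE cauchy_schwarz_sum.
Qed.

(** The condition on the trace says that the squared Frobenius norm of U - 1,
    which is 2(n - tr U), is below 2. As v^T U v = |v|^2 - |(U - 1) v|^2 / 2 for
    orthogonal [U], the symmetric part of [U] is then positive definite. The
    form with a matrix [D] applies this to all columns at once. *)
Lemma near1_definite (R : realType) n p (U : 'M[R]_n) (D : 'M[R]_(n, p)) :
  U^T *m U = 1%:M -> n%:R - 1 < \tr U -> D != 0 -> 0 < \tr (D^T *m U *m D).
Proof.
move=> oU trU D0.
have E : \tr (((U - 1%:M) *m D)^T *m ((U - 1%:M) *m D)) =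
    2 * \tr (D^T *m D) - 2 * \tr (D^T *m U *m D).
  rewrite mulmxBl mul1mx trmxB mulmxBl !mulmxBr trmx_mul.
  rewrite -(mulmxA _ U^T (U *m D)) (mulmxA U^T) oU mul1mx !mxtraceB !mulmxA.
  have -> : \tr (D^T *m U^T *m D) = \tr (D^T *m U *m D).
    by rewrite -mxtrace_tr !trmx_mul !trmxK mulmxA.
  ring.
have F : \tr ((U - 1%:M)^T *m (U - 1%:M)) = 2 * (n%:R - \tr U).
  rewrite trmxB trmx1 mulmxBl !mulmxBr oU mul1mx !mulmx1 !mxtraceB.
  rewrite mxtrace1 mxtrace_tr; ring.
have := frobenius_mul_le (U - 1%:M) D; rewrite E F.
have : 0 < \tr (D^T *m D).
  rewrite lt_neqAle frobenius_ge0 andbT eq_sym; apply: contra D0 => /eqP trD.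
  by apply/eqP; exact: frobenius_eq0.
move: (\tr _) (\tr _) (\tr _) trU => a b c; nra.
Qed.

Lemma orthogonal_commute_tr (R : realType) n (U T : 'M[R]_n) :
  U^T *m U = 1%:M -> U *m T = T *m U -> U^T *m T = T *m U^T.
Proof.
move=> oU UT; rewrite -[LHS]mulmx1 -(mulmx1C oU) -!mulmxA (mulmxA T) -UT.
by rewrite -!mulmxA !mulmxA oU mul1mx.
Qed.

(** Write U = a + s with [a] symmetric and [s] skew; they commute and
    s^2 = a^2 - 1. On an eigenspace of [a] with eigenvalue cos(th) the logarithm
    is s th / sin(th), so it is [s] times a function of [a]. The eigenvalues of
    [a] lie in (0, 1], where that function is finite. The last clause keeps the
    logarithm inside every algebra that is the commutant of some set and
    contains [U]. *)
Lemma orthogonal_near1_log (R : realType) n (U : 'M[R]_n.+1) :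
  U^T *m U = 1%:M -> n.+1%:R - 1 < \tr U ->
  exists Y : 'M[R]_n.+1, [/\ Y^T = - Y, expmx Y = U &
    forall T, U *m T = T *m U -> Y *m T = T *m Y].
Proof.
move=> oU trU; have oU' := mulmx1C oU.
pose a := 2^-1 *: (U + U^T); pose s := 2^-1 *: (U - U^T).
have UE : U = a + s.
  by apply/matrixP => i j; rewrite !mxE; field.
have aT : a^T = a by rewrite /a linearZ linearD /= trmxK addrC.
have sT : s^T = - s by rewrite /s linearZ /= trmxB trmxK -scalerN opprB.
have acomm T : U *m T = T *m U -> a *m T = T *m a.
  move=> UT; rewrite /a -scalemxAl -scalemxAr mulmxDl mulmxDr UT.
  by rewrite orthogonal_commute_tr.
have scomm T : U *m T = T *m U -> s *m T = T *m s.
  move=> UT; rewrite /s -scalemxAl -scalemxAr mulmxBl mulmxBr UT.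
  by rewrite orthogonal_commute_tr.
have as_ : a *m s = s *m a.
  by apply: acomm; apply/esym/scomm.
have ss : s *m s = a *m a - 1%:M.
  rewrite /s /a -!scalemxAl -!scalemxAr !scalerA mulmxBl mulmxDl !mulmxBr !mulmxDr oU oU'.
  move: (U *m U) (U^T *m U^T) => UU VV.
  apply/matrixP => i j; rewrite !mxE; by field.
have [k [c [P [resP aE Psym Pcomm]]]] := spectral_resolution aT.
have [PP1 PP2] := resP.
have aP i : a *m P i = c i *: P i.
  rewrite {1}aE mulmx_suml (bigD1 i) //= -scalemxAl PP2 eqxx big1 ?addr0 // => j /negPf ji.
  by rewrite -scalemxAl PP2 ji scaler0.
have sP i : s *m P i = P i *m s by rewrite Pcomm // as_.
pose th i := acos (c i).
have spec i : P i != 0 -> [/\ cos (th i) = c i, sin (th i) ^+ 2 = 1 - c i ^+ 2 &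
    sinc (th i) != 0].
  move=> Pi0.
  have trP : 0 < \tr (P i).
    have := frobenius_ge0 (P i); rewrite Psym PP2 eqxx le_eqVlt => /orP[/eqP tr0|//].
    move: Pi0; rewrite (_ : P i = 0) ?eqxx //; apply: frobenius_eq0.
    by rewrite Psym PP2 eqxx.
  (* The skew part contributes nothing to tr (P_i U P_i). *)
  have c_gt0 : 0 < c i.
    have := near1_definite oU trU Pi0.
    rewrite UE mulmxDr mulmxDl -mulmxA aP Psym -scalemxAr PP2 eqxx.
    have -> : P i *m s *m P i = s *m P i by rewrite -sP -mulmxA PP2 eqxx.
    have -> : \tr (c i *: P i + s *m P i) = c i * \tr (P i).
      rewrite mxtraceD mxtraceZ.
      suff -> : \tr (s *m P i) = 0 by rewrite addr0.
      have : \tr (s *m P i) = - \tr (s *m P i).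
        by rewrite -{1}mxtrace_tr trmx_mul sT Psym mulmxN mxtraceN sP.
      by move: (\tr _) => x; lra.
    by rewrite pmulr_lgt0.
  (* The squared norm of s P_i is (1 - c_i^2) times that of P_i. *)
  have c_le1 : c i <= 1.
    have := frobenius_ge0 (s *m P i).
    rewrite trmx_mul sT Psym mulmxN mulNmx -mulmxA (mulmxA s) ss mulmxBl mul1mx.
    rewrite -mulmxA aP -scalemxAr aP scalerA mulmxBr -scalemxAr PP2 eqxx.
    rewrite mxtraceN mxtraceB mxtraceZ; move: (\tr _) trP => x x0.
    rewrite (_ : - _ = x * (1 - c i ^+ 2)); last by ring.
    rewrite pmulr_rge0 //; nra.
  have cth : cos (th i) = c i by rewrite /th acosK // in_itv /=; lra.
  have sth : sin (th i) ^+ 2 = 1 - c i ^+ 2.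
    by rewrite -cth -(cos2Dsin2 (th i)); ring.
  split => //; rewrite /sinc; have [|th0] := eqVneq (th i) 0; first by rewrite oner_eq0.
  rewrite mulf_neq0 ?invr_eq0 //; apply/eqP => sin0.
  have c1 : c i = 1 by move: sth; rewrite sin0; nra.
  by move/eqP: th0; apply; rewrite /th c1 acos1.
have sincM x : sinc x * x = sin x :> R.
  by rewrite /sinc; have [->|x0] := eqVneq x 0; rewrite ?sin0 ?mulr0 // divfK.
(* With 1/sinc instead of th/sin the eigenvalue 1, where th = 0, needs no
separate treatment. *)
pose F := \sum_i (sinc (th i))^-1 *: P i.
have FT : F^T = F.
  by rewrite /F linear_sum /=; apply: eq_bigr => i _; rewrite linearZ /= Psym.
have Fcomm T : a *m T = T *m a -> F *m T = T *m F.
  move=> aTT; rewrite /F mulmx_suml mulmx_sumr; apply: eq_bigr => i _.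
  by rewrite -scalemxAl -scalemxAr Pcomm.
have YY : (s *m F) *m (s *m F) = - \sum_i (th i ^+ 2) *: P i.
  rewrite -mulmxA (mulmxA F) (Fcomm _ as_) -mulmxA mulmxA ss.
  rewrite {2}/F resolution_mul // aE resolution_mul // -PP1.
  under [X in _ - X]eq_bigr do rewrite -[P _]scale1r.
  rewrite -sumrB; under eq_bigr do rewrite -scalerBl.
  rewrite resolution_mul // -sumrN; apply: eq_bigr => i _.
  have [->|/spec [_ sth sinc0]] := eqVneq (P i) 0; first by rewrite !scaler0 oppr0.
  rewrite -scaleNr; congr (_ *: _).
  have -> : c i * c i - 1 = - sin (th i) ^+ 2 by rewrite sth; ring.
  by rewrite -sincM; field.
exists (s *m F); split.
- by rewrite trmx_mul FT sT mulmxN (Fcomm _ as_).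
- rewrite (expmxE resP YY) -mulmxA /F resolution_mul // UE; congr (_ + _).
    rewrite aE; apply: eq_bigr => i _.
    by have [->|/spec [-> //]] := eqVneq (P i) 0; rewrite !scaler0.
  rewrite -[RHS]mulmx1 -PP1; congr (_ *m _); apply: eq_bigr => i _.
  have [->|/spec [_ _ sinc0]] := eqVneq (P i) 0; first by rewrite !scaler0.
  by rewrite mulVf // scale1r.
- move=> T UT; rewrite -mulmxA (Fcomm _ (acomm _ UT)) !mulmxA.
  by rewrite (scomm _ UT).
Qed.

(** * Commutants and the variational argument *)

Definition commutes_with (R : realType) n (S : set 'M[R]_n) (T : 'M[R]_n) :=
  forall s, S s -> s *m T = T *m s.

Definition trmx_closed (R : realType) n (S : set 'M[R]_n) := forall s, S s -> S s^T.

Definition orthogonal_commutant (R : realType) n (S : set 'M[R]_n) : set 'M[R]_n :=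
  [set g | orthogonal_mx g /\ commutes_with S g].

Definition skew_commutant (R : realType) n (S : set 'M[R]_n) : set 'M[R]_n :=
  [set X | skew_symmetric_mx X /\ commutes_with S X].

Lemma commutes_with1 (R : realType) n (S : set 'M[R]_n) : commutes_with S 1%:M.
Proof. by move=> s _; rewrite mulmx1 mul1mx. Qed.

Lemma commutes_with_mul (R : realType) n (S : set 'M[R]_n) T U :
  commutes_with S T -> commutes_with S U -> commutes_with S (T *m U).
Proof. by move=> ST SU s Ss; rewrite mulmxA ST // -mulmxA SU // mulmxA. Qed.

Lemma commutes_with_sub (R : realType) n (S : set 'M[R]_n) T U :
  commutes_with S T -> commutes_with S U -> commutes_with S (T - U).
Proof. by move=> ST SU s Ss; rewrite mulmxBr mulmxBl ST // SU. Qed.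

Lemma commutes_with_tr (R : realType) n (S : set 'M[R]_n) T :
  trmx_closed S -> commutes_with S T -> commutes_with S T^T.
Proof.
move=> Str ST s Ss; have := ST _ (Str _ Ss).
by move=> /(congr1 trmx); rewrite !trmx_mul trmxK.
Qed.

Lemma expmx_commutes_with (R : realType) n (S : set 'M[R]_n.+1) X :
  X^T = - X -> commutes_with S X -> commutes_with S (expmx X).
Proof. by move=> skX SX s Ss; apply: expmx_comm => //; exact: SX. Qed.

Lemma expmx_commutant (R : realType) n (S : set 'M[R]_n.+1) X :
  skew_commutant S X -> orthogonal_commutant S (expmx X).
Proof.
move=> [skX SX]; split; first exact: expmx_orthogonal.
exact: expmx_commutes_with.
Qed.

Lemma orthogonal_commutantM (R : realType) n (S : set 'M[R]_n) g h :
  orthogonal_commutant S g -> orthogonal_commutant S h ->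
  orthogonal_commutant S (g *m h).
Proof.
move=> [og Sg] [oh Sh]; split; last exact: commutes_with_mul.
by rewrite /orthogonal_mx trmx_mul -mulmxA (mulmxA _ g) og mul1mx.
Qed.

Lemma conj_commutes_with (R : realType) n (S : set 'M[R]_n) g T :
  trmx_closed S -> orthogonal_commutant S g -> commutes_with S T ->
  commutes_with S (g *m T *m g^T).
Proof.
move=> Str [_ Sg] ST; apply: commutes_with_mul; first exact: commutes_with_mul.
exact: commutes_with_tr.
Qed.

Lemma conj_skew_commutant (R : realType) n (S : set 'M[R]_n) g X :
  trmx_closed S -> orthogonal_commutant S g -> skew_commutant S X ->
  skew_commutant S (g *m X *m g^T).
Proof.
move=> Str Sg [skX SX]; split; last exact: conj_commutes_with.
by rewrite /skew_symmetric_mx !trmx_mul trmxK skX mulNmx mulmxN mulmxA.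
Qed.

Lemma closed_mx_eq (R : realType) (T : topologicalType) m n (f g : T -> 'M[R]_(m, n)) :
  continuous f -> continuous g -> closed [set x | f x = g x].
Proof.
move=> cf cg; rewrite (_ : [set _ | _] = (fun x => f x - g x) @^-1` [set 0]).
  apply: preimage_closed; first by move=> x _; apply: cvgB; [exact: cf|exact: cg].
  exact/accessible_closed_set1/hausdorff_accessible/norm_hausdorff.
by apply/seteqP; split => x /= => [->|/eqP]; rewrite ?subrr // subr_eq0 => /eqP.
Qed.

Lemma continuous_mulmx (R : realType) (T : topologicalType) m n p
    (f : T -> 'M[R]_(m, n)) (g : T -> 'M[R]_(n, p)) :
  continuous f -> continuous g -> continuous (fun x => f x *m g x).
Proof. by move=> cf cg x; apply: cvg_mulmx; [exact: cf|exact: cg]. Qed.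

Lemma continuous_trmx (R : realType) (T : topologicalType) m n (f : T -> 'M[R]_(m, n)) :
  continuous f -> continuous (fun x => (f x)^T).
Proof. by move=> cf x; apply: cvg_trmx; exact: cf. Qed.

Lemma continuous_mxtrace (R : realType) (T : topologicalType) n (f : T -> 'M[R]_n) :
  continuous f -> continuous (fun x => \tr (f x)).
Proof. by move=> cf x; apply: cvg_mxtrace; exact: cf. Qed.

Lemma orthogonal_entry_le1 (R : realType) n (g : 'M[R]_n) i j :
  orthogonal_mx g -> `|g i j| <= 1.
Proof.
move=> /matrixP /(_ j j); rewrite !mxE eqxx => gj.
rewrite -(@ler_pXn2r _ 2) ?nnegrE // expr1n real_normK ?num_real // -[leRHS]gj.
rewrite (bigD1 i) //= mxE -expr2 lerDl; apply: sumr_ge0 => k _.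
by rewrite mxE -expr2 sqr_ge0.
Qed.

(** The entries of an orthogonal matrix lie in [-1, 1], so the set is, up to the
    identification [vec_mx], a closed subset of a cube. *)
Lemma orthogonal_commutant_compact (R : realType) n (S : set 'M[R]_n) :
  compact (orthogonal_commutant S).
Proof.
have vec_cont : continuous (@vec_mx R n n).
  move=> v; apply: (@mx_cvg _ _ (nbhs v)) => i j; rewrite mxE.
  rewrite (_ : (fun x : 'rV[R]_(n * n) => _) = fun x => x ord0 (mxvec_index i j)).
    exact: coord_continuous.
  by apply/funext => x; rewrite mxE.
pose A := @vec_mx R n n @^-1` orthogonal_commutant S.
rewrite (_ : orthogonal_commutant S = @vec_mx R n n @` A); last first.
  apply/seteqP; split=> [g Sg|_ [v Av <-] //].
  by exists (mxvec g); rewrite /A /= mxvecK.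
apply: continuous_compact; first exact: continuous_subspaceT.
have box : compact [set v : 'rV[R]_(n * n) | forall i, `[(-1 : R), 1]%classic (v ord0 i)].
  apply: (@rV_compact R (n * n)%N (fun=> `[(-1 : R), 1]%classic)) => _; exact: segment_compact.
apply: subclosed_compact box _; last first.
  move=> v [ov _] k; case/mxvec_indexP: k => i j.
  have := orthogonal_entry_le1 i j ov.
  by rewrite mxE /= in_itv /= ler_norml.
rewrite (_ : A = [set v | (vec_mx v)^T *m vec_mx v = 1%:M :> 'M[R]_n] `&`
   \bigcap_(s in S) [set v | s *m vec_mx v = vec_mx v *m s]) //.
apply: closedI; [|apply: closed_bigI => s _]; apply: closed_mx_eq.
- by apply: continuous_mulmx; [exact: continuous_trmx|exact: vec_cont].
- exact: cst_continuous.
- by apply: continuous_mulmx; [exact: cst_continuous|exact: vec_cont].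
- by apply: continuous_mulmx; [exact: vec_cont|exact: cst_continuous].
Qed.

(** Take [g] maximizing tr(g M g^T Y) over the compact group of orthogonal
    matrices commuting with [S]; let M' = g M g^T and K = M' Y - Y M'. The first
    variation along exp(tZ), with [Z] skew and commuting with [S], is tr(Z K),
    hence zero. As K - K^T is an admissible [Z] and the trace of (K - K^T) K is
    -1/2 times the squared norm of K - K^T, the matrix [K] is symmetric. *)
Lemma variational_commutation (R : realType) n (S : set 'M[R]_n.+1) (M Y : 'M[R]_n.+1) :
  trmx_closed S -> commutes_with S M -> commutes_with S Y ->
  exists g, [/\ orthogonal_commutant S g,
    \tr (M *m Y) <= \tr (g *m M *m g^T *m Y) &
    (g *m M *m g^T *m Y - Y *m (g *m M *m g^T))^T =
     g *m M *m g^T *m Y - Y *m (g *m M *m g^T)].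
Proof.
move=> Str SM SY.
have S1 : orthogonal_commutant S 1%:M.
  by split; [rewrite /orthogonal_mx trmx1 mulmx1|exact: commutes_with1].
have cont : continuous (fun h : 'M[R]_n.+1 => h *m M *m h^T *m Y).
  have cid : continuous (fun h : 'M[R]_n.+1 => h) by move=> h; exact: cvg_id.
  apply: continuous_mulmx; last exact: cst_continuous.
  apply: continuous_mulmx; last exact: continuous_trmx.
  by apply: continuous_mulmx => //; exact: cst_continuous.
have [g /set_mem Sg gmax] : exists2 g, g \in orthogonal_commutant S &
    forall h, h \in orthogonal_commutant S ->
      \tr (h *m M *m h^T *m Y) <= \tr (g *m M *m g^T *m Y).
  apply: compact_EVT_max; first by exists 1%:M.
    exact: orthogonal_commutant_compact.
  exact/continuous_subspaceT/continuous_mxtrace.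
exists g; split => //.
  by have := gmax _ (mem_set S1); rewrite trmx1 mulmx1 mul1mx.
set M' := g *m M *m g^T; set K := M' *m Y - Y *m M'; pose Z := K - K^T.
have SM' : commutes_with S M' by exact: conj_commutes_with.
have SK : commutes_with S K by apply: commutes_with_sub; apply: commutes_with_mul.
have SZ : commutes_with S Z by apply: commutes_with_sub => //; exact: commutes_with_tr.
have skZ : Z^T = - Z by rewrite /Z trmxB trmxK [RHS]opprB.
have skNZ : (- Z)^T = - - Z by rewrite linearN /= skZ.
pose phi t := \tr (expmx (t *: Z) *m M' *m expmx (t *: - Z) *m Y).
have phi_max t : phi t <= phi 0.
  have sktZ : (t *: Z)^T = - (t *: Z) by rewrite linearZ /= skZ scalerN.
  have Sh : orthogonal_commutant S (expmx (t *: Z) *m g).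
    apply: orthogonal_commutantM => //; apply: expmx_commutant; split => // s Ss.
    by rewrite -scalemxAr -scalemxAl SZ.
  have := gmax _ (mem_set Sh); rewrite trmx_mul (trmx_expmx sktZ) -scalerN.
  by rewrite /phi !scale0r expmx0 mulmx1 mul1mx /M' !mulmxA.
have := mx_is_derive_mulmx (mx_is_derive_mulmx (mx_is_derive_mulmx
  (expmx_is_derive skZ) (mx_is_derive_cst M')) (expmx_is_derive skNZ)) (mx_is_derive_cst Y).
set F' := (F' in mx_is_derive _ F'); move=> dF.
have dphi t : is_derive t (1 : R) phi (\tr (F' t)).
  exact: is_derive_sumfun.
have dphi0 : is_derive (0 : R) (1 : R) phi 0.
  apply: (@derive1_at_max _ _ (-1) 1); rewrite ?in_itv /= //; try lra.
have trZK : \tr (Z *m K) = 0.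
  have <- : \tr (F' 0) = 0.
    by rewrite -(@derive_val _ _ _ _ _ _ _ (dphi 0)) derive_val.
  rewrite /F' !scale0r expmx0 !mulmx1 !mul1mx mulmx0 !addr0 mulmxN.
  rewrite mulmxDl mulNmx mxtraceD mxtraceN /K mulmxBr mxtraceB !mulmxA.
  by rewrite -(mulmxA M' Z Y) [in RHS](mxtrace_mulC M' (Z *m Y)) !mulmxA.
have : Z = 0.
  apply: frobenius_eq0; rewrite skZ mulNmx mxtraceN {2}/Z mulmxBr mxtraceB trZK sub0r opprK.
  by rewrite -mxtrace_tr trmx_mul trmxK skZ mulmxN mxtraceN mxtrace_mulC trZK oppr0.
by move/eqP; rewrite /Z subr_eq0 => /eqP <-.
Qed.

(** * Orthogonal matrices close to an exponential *)

(** Let D = W - W', a symmetric matrix. Subtracting the two orthogonality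
    relations, multiplying by [D] and taking traces gives
    tr(D W D) + tr(D W' D) = 0, whereas both traces are positive unless D = 0. *)
Lemma orthogonal_near1_eq (R : realType) n (W W' : 'M[R]_n) :
  W^T *m W = 1%:M -> W'^T *m W' = 1%:M ->
  n%:R - 1 < \tr W -> n%:R - 1 < \tr W' ->
  W - W^T = W' - W'^T -> W = W'.
Proof.
move=> oW oW' nW nW' skE; apply/eqP; rewrite -subr_eq0; apply/contraT => D0.
move DE : (W - W') D0 => D D0.
have DT : D^T = D.
  by apply/matrixP => i j; move/matrixP: skE => /(_ i j); rewrite -DE !mxE; lra.
have WE : W = W' + D by rewrite -DE addrC subrK.
have := near1_definite oW nW D0; have := near1_definite oW' nW' D0.
rewrite DT WE mulmxDr mulmxDl mxtraceD.
have : \tr (D *m W' *m D) + \tr (D *m W' *m D) + \tr (D *m D *m D) = 0.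
  have -> : \tr (D *m W' *m D) + \tr (D *m W' *m D) =
      \tr ((W'^T *m D + D *m W') *m D).
    rewrite mulmxDl mxtraceD; congr (_ + _).
    by rewrite -[RHS]mxtrace_tr !trmx_mul trmxK DT [RHS]mxtrace_mulC.
  have H : W'^T *m W' + (W'^T *m D + (D *m W' + D *m D)) = W'^T *m W'.
    by rewrite addrA -!mulmxDr -mulmxDl -{1}DT -linearD /= -WE oW oW'.
  rewrite -mxtraceD -mulmxDl; have -> : W'^T *m D + D *m W' + D *m D = 0.
    by apply: (addrI (W'^T *m W')); rewrite addr0 -[RHS]H !addrA.
  by rewrite mul0mx mxtrace0.
lra.
Qed.

(** The bound on the trace does not depend on [X0], which is what makes the set
    of exponentials both open and closed in the orthogonal commutant. *)
Lemma near_exponential (R : realType) n (S : set 'M[R]_n.+1) (X0 Q : 'M[R]_n.+1) :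
  trmx_closed S -> skew_commutant S X0 -> orthogonal_commutant S Q ->
  n.+1%:R - 1 < \tr (expmx X0 *m Q^T) -> (@expmx R n.+1 @` skew_commutant S) Q.
Proof.
move=> Str SX0 [oQ SQ] nQ; have oQ' := mulmx1C oQ.
have SQT := commutes_with_tr Str SQ.
have [oQ0 SQ0] := expmx_commutant SX0.
have [g [Sg trg symg]] := variational_commutation Str SQ0 SQT.
set X1 := g *m X0 *m g^T.
have [skX1 SX1] : skew_commutant S X1 by exact: conj_skew_commutant.
set Q1 := expmx X1.
have Q1E : g *m expmx X0 *m g^T = Q1.
  by rewrite /Q1 expmx_conj //; [case: Sg|case: SX0].
rewrite {}Q1E in trg symg.
have [oQ1 SQ1] : orthogonal_commutant S Q1 by exact: expmx_commutant.
have oQ1' := mulmx1C oQ1.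
have Q1QT : Q1 *m Q^T = Q^T *m Q1.
  apply: orthogonal_near1_eq.
  - by rewrite trmx_mul trmxK -mulmxA (mulmxA Q1^T) oQ1 mul1mx.
  - by rewrite trmx_mul trmxK -mulmxA (mulmxA Q) oQ' mul1mx.
  - exact: lt_le_trans trg.
  - by rewrite mxtrace_mulC; exact: lt_le_trans trg.
  - move: symg; rewrite trmxB => /matrixP E; apply/matrixP => i j.
    by have := E i j; rewrite !mxE; lra.
have Q1Q : Q1 *m Q = Q *m Q1.
  rewrite -[LHS]mul1mx -oQ' -!mulmxA (mulmxA Q^T) -Q1QT -!mulmxA oQ.
  by rewrite mulmx1.
set U := Q *m Q1^T.
have UQ1 : U *m Q1 = Q by rewrite -mulmxA oQ1 mulmx1.
have [||Y [skY YE Ycomm]] := @orthogonal_near1_log _ _ U.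
- by rewrite trmx_mul trmxK -mulmxA (mulmxA Q^T) oQ mul1mx.
- by rewrite -mxtrace_tr trmx_mul trmxK; exact: lt_le_trans trg.
(* Enlarging S by Q1 makes the second conjugation fix Q1 = exp X1 while it
moves the logarithm X1. *)
pose S' := S `|` [set Q1; Q1^T].
have S'tr : trmx_closed S'.
  move=> s [/Str|[->|->]]; [by left|by right; right|].
  by rewrite trmxK; right; left.
have S'X1 : skew_commutant S' X1.
  have cX1 : Q1 *m X1 = X1 *m Q1 by apply/esym/expmx_comm.
  by split => // s [/SX1 //|[->|->] //]; exact: orthogonal_commute_tr.
have S'Y : skew_commutant S' Y.
  have cY : Q1 *m Y = Y *m Q1.
    by apply/esym/Ycomm; rewrite UQ1 /U mulmxA Q1Q -mulmxA oQ1' mulmx1.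
  split => // s [Ss|[->|->] //]; last exact: orthogonal_commute_tr.
  apply/esym/Ycomm/esym; apply: commutes_with_mul Ss => //.
  exact: commutes_with_tr.
have [h [S'h _ symh]] := variational_commutation S'tr S'X1.2 S'Y.2.
set X2 := h *m X1 *m h^T in symh.
have S'X2 : skew_commutant S' X2 by exact: conj_skew_commutant.
have X2E : expmx X2 = Q1.
  rewrite /X2 expmx_conj //; last by case: S'h.
  have [oh ch] := S'h; rewrite -(ch Q1) -/Q1; last by right; left.
  by rewrite -mulmxA (mulmx1C oh) mulmx1.
clearbody X2; have skX2 : X2^T = - X2 := S'X2.1.
(* The commutator of two skew matrices is skew; being symmetric too, it is zero. *)
have X2Y : Y *m X2 = X2 *m Y.
  move: symh; rewrite trmxB !trmx_mul skX2 skY !mulNmx !mulmxN !opprK.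
  move=> /matrixP E; apply/matrixP => i j; have := E i j; rewrite !mxE; lra.
exists (Y + X2); last by rewrite expmxD ?YE ?X2E ?UQ1.
split; first by rewrite /skew_symmetric_mx linearD /= skY skX2 opprD.
by move=> s Ss; rewrite mulmxDr mulmxDl S'Y.2 ?S'X2.2 //; left.
Qed.

(** * Connected sets of symmetries *)

(** Both [E] and its complement are relatively open in [D]: around each point
    of either, the neighbourhood [U x] stays on the same side. *)
Lemma connected_uniform_sub (T : topologicalType) (D E : set T) (U : T -> set T) :
  connected D -> (forall x, open (U x)) -> (forall x, D x -> U x x) ->
  (forall x y, U x y -> U y x) ->
  (forall x y, D x -> E x -> D y -> U x y -> E y) ->
  D `&` E !=set0 -> D `<=` E.
Proof.
move=> cD oU Ux symU UE DE.
have : D `&` E = D; last by move=> <- x [].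
apply: cD => //.
- exists (\bigcup_(x in D `&` E) U x); first by apply: bigcup_open.
  apply/seteqP; split=> [x [Dx Ex]|y [Dy [x [Dx Ex] Uxy]]].
    by split=> //; exists x => //; exact: Ux.
  by split=> //; exact: UE Uxy.
- exists (~` \bigcup_(x in D `&` ~` E) U x).
    by apply: open_closedC; apply: bigcup_open.
  apply/seteqP; split=> [y [Dy Ey]|y [Dy nUy]]; split=> //.
    by move=> [x [Dx nEx] Uxy]; apply: nEx; exact: (UE y x Dy Ey Dx (symU _ _ Uxy)).
  by apply: contrapT => nEy; apply: nUy; exists y => //; exact: Ux.
Qed.

Lemma connected_commutant_exp (R : realType) n (S D : set 'M[R]_n.+1) :
  trmx_closed S -> connected D -> D 1%:M -> D `<=` orthogonal_commutant S ->
  D `<=` @expmx R n.+1 @` skew_commutant S.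
Proof.
move=> Str cD D1 DS.
apply: (@connected_uniform_sub _ D _
  (fun x => [set y | n.+1%:R - 1 < \tr (x *m y^T)]) cD).
- move=> x; apply: (@open_comp _ _ (fun y : 'M[R]_n.+1 => \tr (x *m y^T))
    [set z : R | z > n.+1%:R - 1]); last exact: open_gt.
  have cid : continuous (fun h : 'M[R]_n.+1 => h) by move=> h; exact: cvg_id.
  move=> y _; apply: (@continuous_mxtrace _ _ _ (fun h : 'M[R]_n.+1 => x *m h^T)).
  by apply: continuous_mulmx; [exact: cst_continuous|exact: continuous_trmx].
- move=> x /DS [/mulmx1C ox _] /=; rewrite ox mxtrace1; lra.
- by move=> x y /=; rewrite -mxtrace_tr trmx_mul trmxK.
- move=> x y _ [X SX <-] /DS Sy; exact: near_exponential.
- exists 1%:M; split => //; exists 0; last exact: expmx0.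
  split; first by rewrite /skew_symmetric_mx trmx0 oppr0.
  by move=> s _; rewrite mulmx0 mul0mx.
Qed.

(** On [D] the map Q |-> Q^T B_i Q takes its values among the finitely many
    [B j], so its fibres are relatively open and closed. *)
Lemma connected_symmetries_commute (R : realType) n M (A : 'M[R]_n) (B : 'I_M -> 'M[R]_n)
    (D : set 'M[R]_n) :
  connected D -> D 1%:M -> D `<=` symmetry_group A B ->
  forall Q i, D Q -> Q^T *m B i *m Q = B i.
Proof.
move=> cD D1 DG Q i DQ; pose f (Q : 'M[R]_n) := Q^T *m B i *m Q.
have fB P : D P -> exists j, f P = B j.
  move=> /DG [_ _ [L [/is_perm_mxP [s ->] LB]]]; exists (s i).
  rewrite /f LB (bigD1 (s i)) //= big1 ?addr0.
    by rewrite !mxE eqxx scale1r.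
  by move=> j /negPf ji; rewrite !mxE eq_sym ji scale0r.
have closed_fiber (C : 'M[R]_n) : closed [set P | f P = C].
  apply: closed_mx_eq; last exact: cst_continuous.
  have cid : continuous (fun h : 'M[R]_n => h) by move=> h; exact: cvg_id.
  apply: continuous_mulmx => //; apply: continuous_mulmx; last exact: cst_continuous.
  exact: continuous_trmx.
have : D `&` [set P | f P = B i] = D; last by move=> E; move: DQ; rewrite -E => -[].
apply: cD; last by exists [set P | f P = B i].
- by exists 1%:M; split => //=; rewrite /f trmx1 mul1mx mulmx1.
- exists (~` \bigcup_(j in [set j | B j <> B i]) [set P | f P = B j]).
    apply: closed_openC; apply: closed_bigcup; last by move=> j _; exact: closed_fiber.
    exact: finite_finset.
  apply/seteqP; split=> P [DP] /= fP; split=> //=.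
    by move=> [j ji] /=; rewrite fP => /esym.
  have [j fj] := fB _ DP; rewrite fj; apply: contrapT => ji.
  by apply: fP; exists j.
Qed.

(** The set formed by the matrices is closed under transposition because each
    of them is symmetric, so its commutant is an algebra with involution, and
    [connected_commutant_exp] applies. *)
Lemma continuous_symmetriesE (R : realType) n M (A : 'M[R]_n.+1) (B : 'I_M -> 'M[R]_n.+1) :
  A^T = A -> (forall i, (B i)^T = B i) ->
  continuous_symmetries A B = [set expmx X | X in infinitesimal_symmetry A B].
Proof.
move=> symA symB; pose S : set 'M[R]_n.+1 := [set s | s = A \/ exists i, s = B i].
have Str : trmx_closed S.
  by move=> _ [->|[i ->]]; [left|right; exists i].
have infS X : infinitesimal_symmetry A B X <-> skew_commutant S X.
  split=> [[skX AX BX]|[skX SX]]; first by split => // _ [->|[i ->]].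
  by split => // [|i]; apply: SX; [left|right; exists i].
have commG Q : orthogonal_commutant S Q -> symmetry_group A B Q.
  move=> [oQ SQ]; have conj s : S s -> Q^T *m s *m Q = s.
    by move=> Ss; rewrite -mulmxA SQ // mulmxA oQ mul1mx.
  split=> //; first by apply: conj; left.
  exists 1%:M; split; first exact: is_perm_mx1.
  move=> i; rewrite conj; last by right; exists i.
  rewrite (bigD1 i) //= big1 ?addr0; first by rewrite mxE eqxx scale1r.
  by move=> j /negPf ji; rewrite mxE eq_sym ji scale0r.
apply/seteqP; split.
- move=> Q [D [D1 DG cD] DQ].
  have DS : D `<=` orthogonal_commutant S.
    move=> P DP; have [oP AP _] := DG _ DP; split => // s Ss.
    suff PsP : P^T *m s *m P = s.
      by rewrite -{2}PsP !mulmxA (mulmx1C oP) mul1mx.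
    case: Ss => [->//|[i ->]]; exact: (connected_symmetries_commute cD D1 DG).
  have [X /infS SX <-] := connected_commutant_exp Str cD D1 DS DQ.
  by exists X.
- move=> _ [X /infS SX <-]; have [skX _] := SX.
  pose D := (fun t : R => expmx (t *: X)) @` `[0, 1].
  have : D (expmx X) by exists 1; [rewrite /= in_itv /= ler01 lexx|rewrite scale1r].
  apply: connected_component_max.
  + by exists 0; [rewrite /= in_itv /= ler01 lexx|rewrite scale0r expmx0].
  + move=> _ [t _ <-]; apply/commG/expmx_commutant; have [_ cX] := SX; split.
      by rewrite /skew_symmetric_mx linearZ /= skX scalerN.
    by move=> s Ss; rewrite -scalemxAr -scalemxAl cX.
  + apply: connected_continuous_connected; first exact: segment_connected.
    apply: continuous_subspaceT; exact: mx_is_derive_cvg (expmx_is_derive skX).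
Qed.

Theorem theorem1 (R : realType) (N M : nat) (hN : (1 <= N)%N) (hM : (1 <= M)%N)
    (A : 'M[R]_N) (B : 'I_M -> 'M[R]_N)
    (hA : symmetric_mx A) (hB : forall i : 'I_M, symmetric_mx (B i))
    (hBsum : posdef_mx (\sum_(i < M) B i))
    (S : 'M[R]_N) (hS : S \in unitmx) (hBS : \sum_(i < M) B i = S^T *m S)
    (At : 'M[R]_N) (hAt : At = (invmx S)^T *m A *m invmx S)
    (Bt : 'I_M -> 'M[R]_N)
    (hBt : forall i : 'I_M, Bt i = (invmx S)^T *m B i *m invmx S)
    (V : {vspace 'M[R]_N})
    (hV : forall X : 'M[R]_N, X \in V <-> infinitesimal_symmetry At Bt X)
    (K : nat) (G : K.-tuple 'M[R]_N) (hG : basis_of V G) :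
  continuous_symmetries At Bt =
  [set expmx (\sum_(n < K) a n *: tnth G n) | a in [set: 'I_K -> R]].
Proof.
case: N hN A B hA hB hBsum S hS hBS At hAt Bt hBt V hV G hG => // n _.
move=> A B hA hB _ S _ _ At hAt Bt hBt V hV G hG.
have symconj (C : 'M[R]_n.+1) : C^T = C ->
    ((invmx S)^T *m C *m invmx S)^T = (invmx S)^T *m C *m invmx S.
  by move=> CT; rewrite !trmx_mul trmxK CT mulmxA.
rewrite continuous_symmetriesE; last 2 first.
- by rewrite hAt symconj.
- by move=> i; rewrite hBt symconj //; exact: hB.
apply/seteqP; split=> [_ [X /hV VX <-]|_ [a _ <-]].
- exists (coord G ^~ X) => //; congr expmx.
  by rewrite [RHS](coord_basis hG VX); apply: eq_bigr => i _; rewrite (tnth_nth 0).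
- exists (\sum_(i < K) a i *: tnth G i) => //; apply/hV.
  apply: memv_suml => i _; apply: memvZ; rewrite -(span_basis hG).
  by apply: memv_span; exact: mem_tnth.
Qed.
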